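(* Let $\mathcal J=(\mathcal S,\mathcal A,\gamma,J)$ be a finite JMDP with $d=|\mathcal A|\ge 2$, and assume that the induced marginal MDP has a unique optimal action at every state, i.e. for every $s\in\mathcal S$ the set $\arg\max_{a\in\mathcal A}Q^*(s,a)$ is a singleton $\{\pi^*(s)\}$ (equivalently, since $\mathcal S,\mathcal A$ are finite, $\Delta^*=\min_{s\in\mathcal S}\bigl(Q^*(s,\pi^*(s))-\max_{a\ne\pi^*(s)}Q^*(s,a)\bigr)>0$). Then for any $p\ge 1$ and any $\eta_0\in\mathcal E_p$, the iterates $\eta_{k+1}=\mathcal T_G\eta_k$ ($k\ge 0$) satisfy $$D_p\bigl(\eta_k,\eta^{\pi^*}_{\mathcal H}\bigr)\to 0\quad\text{as }k\to\infty .$$ In particular, $W_p\bigl(\eta_k(h_s),\eta^{\pi^*}_{\mathcal H}(h_s)\bigr)\to 0$ for every $s\in\mathcal S$.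
   Context: **JMDP.** A finite JMDP is a tuple $\mathcal J=(\mathcal S,\mathcal A,\gamma,J)$ with $\mathcal S,\mathcal A$ finite nonempty sets, $\gamma\in(0,1)$, and $J$ a Markov kernel assigning to each $s\in\mathcal S$ a probability measure $J(\cdot\mid s)$ on $([0,1]\times\mathcal S)^{|\mathcal A|}$; a draw $((R^a,S'^a))_{a\in\mathcal A}\sim J(\cdot\mid s)$ is called an outcome table at $s$. **Marginal MDP.** The induced marginal MDP has reward-transition kernel $P_{\mathcal J}(\cdot\mid s,a)$ equal to the law of the coordinate $(R^a,S'^a)$ under $J(\cdot\mid s)$. Its optimal action-value function $Q^*:\mathcal S\times\mathcal A\to\mathbb R$ is the unique fixed point of $(TQ)(s,a)=\mathbb E[R^a+\gamma\max_{b\in\mathcal A}Q(S'^a,b)]$, with the expectation over $J(\cdot\mid s)$. When the optimal action at each state is unique, $\pi^*$ denotes the resulting deterministic policy. **Configurations.** Let $d=|\mathcal A|\ge 2$, fix an ordering of $\mathcal A$, and set $\mathcal H_d=(\mathcal S\times\mathcal A)^d$. Elements $h=((s_i,a_i))_{i=1}^d$ are called configurations, and $h_i=(s_i,a_i)$. For $s\in\mathcal S$, $h_s=((s,a))_{a\in\mathcal A}$. **Families of laws.** $\mathcal P_p(\mathbb R^d)$ is the set of Borel probability measures on $\mathbb R^d$ with finite $p$th moment. $\mathcal E_p$ is the set of families $\eta\in\mathcal P_p(\mathbb R^d)^{\mathcal H_d}$ that are marginally consistent: writing $\mathrm{pr}_i$ for the $i$th coordinate projection, $(\mathrm{pr}_i)_\#\eta(h)=(\mathrm{pr}_j)_\#\eta(\tilde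 h)$ whenever $h_i=\tilde h_j$ ($h,\tilde h\in\mathcal H_d$, $1\le i,j\le d$). For $\eta\in\mathcal E_p$, $\eta_{s,a}$ denotes the common scalar marginal attached to $(s,a)$. **Fixed-policy operator.** Let $\pi:\mathcal S\to\mathcal A$ be a deterministic policy and $h=((s_i,a_i))_{i=1}^d$. Sample one outcome table from $J(\cdot\mid\bar s)$ for every distinct state $\bar s$ among $s_1,\dots,s_d$, independently across distinct states. Let $(R_i,S'_i)$ be the coordinate for action $a_i$ in the table sampled at $s_i$, and set $h'=((S'_i,\pi(S'_i)))_{i=1}^d$. Conditional on $h'$, draw $Z'\sim\eta(h')$ independently of the sampled tables. Then $(\mathcal T^\pi\eta)(h)=\mathrm{Law}\bigl((R_i+\gamma Z'_i)_{i=1}^d\bigr)$. **Return family.** For a deterministic policy $\pi$, $\eta^\pi_{\mathcal H}$ is the family induced by the following branch process. Start from $h^{(0)}=h$. At each time $t$, given $h^{(t)}$, draw fresh outcome tables (one per distinct state appearing in $h^{(t)}$, independent across distinct states and, conditionally on $h^{(t)}$, independent of the past), read off rewards $R_{i,t}$ and successors $S'_{i,t}$ as in the definition of $\mathcal T^\pi$, and set $h^{(t+1)}=((S'_{i,t},\pi(S'_{i,t})))_{i=1}^d$. Then $\eta^\pi_{\mathcal H}(h)=\mathrm{Law}\bigl((\sum_{t\ge0}\gamma^tR_{i,t})_{i=1}^d\bigr)$. It belongs to $\mathcal E_p$ and satisfies $\mathcal T^\pi\eta^\pi_{\mathcal H}=\eta^\pi_{\mathcal H}$; $\eta^\pi_{\mathcal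 H}(h_s)$ is the joint return law of $\pi$ at $s$. **Metrics.** For $\xi,\upsilon\in\mathcal P_p(\mathbb R^d)$, $W_p(\xi,\upsilon)=\inf_{\lambda\in\Pi(\xi,\upsilon)}\bigl(\mathbb E_{(X,Y)\sim\lambda}\|X-Y\|_\infty^p\bigr)^{1/p}$, where $\Pi(\xi,\upsilon)$ is the set of couplings. On $\mathcal E_p$, $D_p(\eta,\zeta)=\max_{h\in\mathcal H_d}W_p(\eta(h),\zeta(h))$. **Greedy operator.** For $\eta\in\mathcal E_p$ let $Q_\eta(s,a)=\mathbb E_{Z\sim\eta_{s,a}}[Z]$. Fix a deterministic tie-breaking rule, so that $G(\eta):\mathcal S\to\mathcal A$ is a policy determined by $\eta$ with $[G(\eta)](s)\in\arg\max_{a\in\mathcal A}Q_\eta(s,a)$ for all $s$. Define $\mathcal T_G\eta:=\mathcal T^{G(\eta)}\eta$. *)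

(* Defs.v *)
From HB Require Import structures.
From mathcomp Require Import all_boot all_order all_algebra.
From mathcomp Require Import all_classical all_reals all_analysis.
From mathcomp Require Import measurable_realfun.

Set Implicit Arguments.
Unset Strict Implicit.
Unset Printing Implicit Defensive.

Import Order.TTheory GRing.Theory Num.Theory.
Import numFieldNormedType.Exports.

Local Open Scope classical_set_scope.
Local Open Scope ring_scope.

(* Nonempty finite types: MathComp-Analysis builds measurable spaces on pointed
   types only, and the chosen point plays no role otherwise. *)
#[short(type="finPointedType")]
HB.structure Definition FinPointed := {T of Finite T & Pointed T}.

(* [S] with its discrete sigma-algebra. *)
Definition discrete_space (S : finPointedType) : Type := S.

HB.instance Definition _ (S : finPointedType) := Pointed.on (discrete_space S).
HB.instance Definition _ (S : finPointedType) :=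
  @isMeasurable.Build default_measure_display (discrete_space S)
    discrete_measurable discrete_measurable0
    discrete_measurableC discrete_measurableU.

Section probability_constructions.
Context d1 d2 (T1 : measurableType d1) (T2 : measurableType d2) (R : realType).

Section product.
Variables (P : probability T1 R) (Q : probability T2 R).

Definition prod_prob : set (T1 * T2) -> \bar R := (P \x Q)%E.

HB.instance Definition _ := Measure.on prod_prob.

Let prod_prob_setT : prod_prob setT = 1%E.
Proof.
rewrite /prod_prob -setXTT [LHS]product_measure1E// -[RHS]mule1.
by congr (_ * _)%E; exact: probability_setT.
Qed.

HB.instance Definition _ :=
  Measure_isProbability.Build _ _ _ prod_prob prod_prob_setT.

End product.

Section mixture.
Variables (P : probability T1 R) (k : T1 -> probability T2 R).
Hypothesis mk : forall B, measurable B -> measurable_fun setT (fun x => k x B).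

(* The law of [y] when [x] is drawn from [P] and then [y] from [k x]. *)
Definition mixture of (forall B, measurable B ->
    measurable_fun setT (fun x => k x B)) : set T2 -> \bar R :=
  fun B => (\int[P]_x k x B)%E.

Let mixture0 : mixture mk set0 = 0%E.
Proof. by rewrite /mixture integral0_eq. Qed.

Let mixture_ge0 B : (0 <= mixture mk B)%E.
Proof. exact: integral_ge0. Qed.

Let mixture_sigma_additive : semi_sigma_additive (mixture mk).
Proof.
move=> F mF tF mUF; rewrite /mixture.
rewrite [X in _ --> X](_ : _ =
    (\int[P]_x (\sum_(0 <= n <oo) k x (F n)))%E); last first.
  apply: eq_integral => x _.
  by apply/esym/cvg_lim => //; exact: measure_semi_sigma_additive.
rewrite integral_nneseries//; last by move=> n; exact: mk.
by apply: is_cvg_nneseries => n _ _; exact: integral_ge0.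
Qed.

HB.instance Definition _ := isMeasure.Build _ _ _ (mixture mk)
  mixture0 mixture_ge0 mixture_sigma_additive.

Let mixture_setT : mixture mk setT = 1%E.
Proof.
rewrite /mixture (eq_integral (cst 1%E)); last first.
  by move=> x _; exact: probability_setT.
by rewrite integral_cst// mul1e; exact: probability_setT.
Qed.

HB.instance Definition _ :=
  Measure_isProbability.Build _ _ _ (mixture mk) mixture_setT.

End mixture.

End probability_constructions.

Section finite_product.
Context d (T : measurableType d) (R : realType).

Definition cons_pair n (x : T * n.-tuple T) : n.+1.-tuple T :=
  [the n.+1.-tuple T of x.1 :: x.2].

Lemma measurable_cons_pair n : measurable_fun setT (@cons_pair n).
Proof. exact: (measurable_cons measurable_fst measurable_snd). Qed.

HB.instance Definition _ n :=
  isMeasurableFun.Build _ _ _ _ (@cons_pair n) (@measurable_cons_pair n).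

(* The law of independent draws from [mu i], for [i] ranging over [l]. *)
Fixpoint seq_prod (I : Type) (mu : I -> probability T R) (l : seq I) :
    probability ((size l).-tuple T) R :=
  match l with
  | [::] => dirac [tuple]
  | i :: l' =>
      distribution (prod_prob (mu i) (seq_prod mu l')) (@cons_pair (size l'))
  end.

End finite_product.

Section jmdp.
Context (R : realType) (S : finPointedType) (A : finType).

(* [R^d], whose sigma-algebra is the product one, i.e. the Borel one. *)
Definition rvec : Type := #|A|.-tuple R.
HB.instance Definition _ := Measurable.on rvec.

(* A list of rewards and successors. As an outcome table, its coordinate
   [enum_rank a] is [(R^a, S'^a)]; as a draw from a configuration [h], its
   coordinate [i] is [(R_i, S'_i)]. *)
Definition outcome : Type := #|A|.-tuple (R * discrete_space S).
HB.instance Definition _ := Measurable.on outcome.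

Definition coordinate (i : 'I_#|A|) (z : rvec) : R := tnth z i.
Lemma measurable_coordinate i : measurable_fun setT (coordinate i).
Proof. exact: measurable_tnth. Qed.
HB.instance Definition _ i :=
  isMeasurableFun.Build _ _ _ _ (coordinate i) (@measurable_coordinate i).

Definition reward (o : outcome) (i : 'I_#|A|) : R := (tnth o i).1.
Definition successor (o : outcome) (i : 'I_#|A|) : S := (tnth o i).2.

(* The outcome tables have real rewards, almost surely in [0, 1]. *)
Record JMDP := {
  discount : R ;
  discount_itv : 0 < discount < 1 ;
  table_law : S -> probability outcome R ;
  table_reward_itv : forall s,
    table_law s [set x | forall i, 0 <= reward x i <= 1] = 1%E
}.

Definition argmax (f : A -> R) : set A := [set a | forall b, f b <= f a].

(* [Q] is a fixed point of the optimality operator of the marginal MDP, where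
   the action [a] is only the starting value of the (nonempty) maximum. *)
Definition is_optimal_Q (J : JMDP) (Q : S -> A -> R) :=
  forall s a,
    (Q s a)%:E = 'E_(table_law J s)[fun x =>
      (reward x (enum_rank a) + discount J *
        \big[Num.max/Q (successor x (enum_rank a)) a]_(b : A)
          Q (successor x (enum_rank a)) b)%R]%E.

Definition config := {ffun 'I_#|A| -> S * A}.

Definition diag_config (s : S) : config := [ffun i => (s, enum_val i)].

Definition law_family := config -> probability rvec R.

Definition supnorm (z : rvec) : R := \big[Num.max/0]_(i < #|A|) `|tnth z i|.

Definition supdist (x y : rvec) : R :=
  supnorm [tuple tnth x i - tnth y i | i < #|A|].

Definition finite_moment (p : R) (xi : probability rvec R) :=
  (\int[xi]_z ((supnorm z) `^ p)%:E < +oo)%E.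

Definition marginally_consistent (eta : law_family) :=
  forall (h h' : config) (i j : 'I_#|A|), h i = h' j ->
  forall B : set R, measurable B ->
    distribution (eta h) (coordinate i) B =
    distribution (eta h') (coordinate j) B.

Definition consistent_family (p : R) (eta : law_family) :=
  (forall h, finite_moment p (eta h)) /\ marginally_consistent eta.

(* The common marginal attached to [(s, a)], read off the configuration [h_s]
   at the position of [a]. *)
Definition marginal (eta : law_family) (s : S) (a : A) : probability R R :=
  distribution (eta (diag_config s)) (coordinate (enum_rank a)).

Definition Qmean (eta : law_family) (s : S) (a : A) : R :=
  (\int[marginal eta s a]_z z)%R.

Definition distinct_states (h : config) : seq S :=
  undup [seq (h i).1 | i <- enum 'I_#|A|].

(* Given one table for each distinct state of [h], the outcomes
   [(R_i, S'_i)]. *)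
Definition read_tables (h : config)
    (x : (size (distinct_states h)).-tuple outcome) : outcome :=
  [tuple tnth (nth point x (index (h i).1 (distinct_states h)))
              (enum_rank (h i).2) | i < #|A|].

Lemma measurable_read_tables h : measurable_fun setT (@read_tables h).
Proof.
apply/measurable_fun_tnthP => i.
rewrite (_ : _ \o _ = (fun t : outcome => tnth t (enum_rank (h i).2)) \o
    (fun x : (size (distinct_states h)).-tuple outcome =>
       nth point x (index (h i).1 (distinct_states h)))); last first.
  by apply/funext => x /=; rewrite tnth_mktuple.
apply: measurableT_comp; first exact: measurable_tnth.
have [lt_j|le_j] := ltnP (index (h i).1 (distinct_states h))
    (size (distinct_states h)); last first.
  rewrite (_ : (fun _ => _) = cst point) //.
  by apply/funext => x; rewrite nth_default// size_tuple.
rewrite (_ : (fun _ => _) = (fun x : (size (distinct_states h)).-tuple outcome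
    => tnth x (Ordinal lt_j))); first exact: measurable_tnth.
by apply/funext => x; rewrite (tnth_nth point).
Qed.

HB.instance Definition _ h :=
  isMeasurableFun.Build _ _ _ _ (@read_tables h) (@measurable_read_tables h).

(* The law of [((R_i, S'_i))_i] when one table is drawn for each distinct state
   of [h], independently. *)
Definition outcome_law (J : JMDP) (h : config) : probability outcome R :=
  distribution (seq_prod (table_law J) (distinct_states h)) (@read_tables h).

Definition next_config (pi : S -> A) (o : outcome) : config :=
  [ffun i => (successor o i, pi (successor o i))].

Definition backup (gamma : R) (o : outcome) (z : rvec) : rvec :=
  [tuple reward o i + gamma * tnth z i | i < #|A|].

Lemma measurable_reward i : measurable_fun setT (reward ^~ i).
Proof. exact: (measurableT_comp measurable_fst (measurable_tnth i)). Qed.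

Lemma measurable_successor i :
  measurable_fun setT (fun o => successor o i : discrete_space S).
Proof. exact: (measurableT_comp measurable_snd (measurable_tnth i)). Qed.

Lemma measurable_backup_pair gamma :
  measurable_fun setT (fun x : outcome * rvec => backup gamma x.1 x.2).
Proof.
apply/measurable_fun_tnthP => i.
rewrite (_ : _ \o _ =
    (fun x : outcome * rvec => reward x.1 i + gamma * coordinate i x.2));
  last first.
  by apply/funext => x /=; rewrite tnth_mktuple.
apply: measurable_funD.
  exact: (measurableT_comp (measurable_reward i) measurable_fst).
apply: measurable_funM => //.
exact: (measurableT_comp (@measurable_coordinate i) measurable_snd).
Qed.

Lemma measurable_backup gamma o : measurable_fun setT (backup gamma o).
Proof.
exact: (measurableT_comp (@measurable_backup_pair gamma)
  (measurable_pair1 o)).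
Qed.

HB.instance Definition _ gamma o := isMeasurableFun.Build _ _ _ _
  (backup gamma o) (@measurable_backup gamma o).

Lemma measurable_next_config pi (k : config) :
  measurable [set o | next_config pi o = k].
Proof.
rewrite (_ : [set _ | _] =
  \bigcap_(i in [set: 'I_#|A|])
    [set o | (successor o i, pi (successor o i)) = k i]); last first.
  apply/seteqP; split => o /= ok; first by move=> i _; rewrite -ok ffunE.
  by apply/ffunP => i; rewrite ffunE ok.
apply: fin_bigcap_measurable; first exact: finite_finset.
move=> i _.
rewrite -[X in measurable X]setTI.
exact: (measurable_successor i measurableT
  (Y := [set s : discrete_space S | (s : S, pi s) = k i])).
Qed.

Section operator.
Variables (J : JMDP) (pi : S -> A) (eta : law_family).

(* The law of [(R_i + gamma Z'_i)_i] given the sampled outcomes [o]. *)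
Definition backup_law (o : outcome) : probability rvec R :=
  distribution (eta (next_config pi o)) (backup (discount J) o).

Lemma measurable_backup_law B : measurable B ->
  measurable_fun setT (fun o => backup_law o B).
Proof.
move=> mB _ Y mY; rewrite setTI.
pose E := (fun x : outcome * rvec => backup (discount J) x.1 x.2) @^-1` B.
have mE : measurable E.
  by rewrite -[E]setTI; exact: measurable_backup_pair.
rewrite (_ : _ @^-1` _ = \bigcup_(k in [set: config])
   ([set o | next_config pi o = k] `&`
    (fun o => eta k (xsection E o)) @^-1` Y)); last first.
  have eqE k o : eta k (xsection E o) = eta k (backup (discount J) o @^-1` B).
    by congr (eta k _); apply/seteqP; split => z /=;
      rewrite /xsection/= ?inE.
  apply/seteqP; split => o /=; first last.
    by case=> k _ [/= ok]; rewrite eqE -ok.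
  by move=> Yo; exists (next_config pi o) => //; split => //=; rewrite eqE.
apply: fin_bigcup_measurable; first exact: finite_finset.
move=> k _.
apply: measurableI; first exact: measurable_next_config.
rewrite -[X in measurable X]setTI.
exact: (measurable_fun_xsection (eta k) mE).
Qed.

Definition policy_operator : law_family :=
  fun h => mixture (outcome_law J h) measurable_backup_law.

End operator.

Definition greedy_operator (J : JMDP) (G : law_family -> S -> A)
    (eta : law_family) : law_family :=
  policy_operator J (G eta) eta.

(* [o t w] is the list of the [(R_{i,t}, S'_{i,t})], and this is [h^(t)]. *)
Definition branch_config (pi : S -> A) (h : config)
    dW (W : measurableType dW) (o : nat -> W -> outcome) (t : nat) (w : W) :
    config :=
  if t is t'.+1 then next_config pi (o t' w) else h.

(* Conditionally on the past outcomes, the [t]-th ones have the law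
   [outcome_law J h^(t)]. *)
Definition branch_process (J : JMDP) (pi : S -> A) (h : config)
    dW (W : measurableType dW) (P : probability W R)
    (o : nat -> W -> outcome) :=
  (forall t, measurable_fun setT (o t)) /\
  (forall (t : nat) (k : config) (B : nat -> set outcome),
    (forall u, measurable (B u)) ->
    P [set w | branch_config pi h o t w = k /\
               forall u, (u <= t)%N -> B u (o u w)] =
    (P [set w | branch_config pi h o t w = k /\
                forall u, (u < t)%N -> B u (o u w)] *
     outcome_law J k (B t))%E).

Definition is_return_law (J : JMDP) (pi : S -> A) (h : config)
    (mu : probability rvec R) :=
  exists (dW : measure_display) (W : measurableType dW) (P : probability W R)
         (o : nat -> W -> outcome) (Z : {mfun W >-> rvec}),
    [/\ branch_process J pi h P o,
        {ae P, forall w i,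
          series (fun t => discount J ^+ t * reward (o t w) i) @ \oo
            --> tnth (Z w) i} &
        forall B, measurable B -> mu B = distribution P Z B].

Definition is_return_family (J : JMDP) (pi : S -> A) (eta : law_family) :=
  forall h, is_return_law J pi h (eta h).

Definition couplings (xi ups : probability rvec R) :
    set (probability (rvec * rvec)%type R) :=
  [set lam | forall B : set rvec, measurable B ->
     lam (B `*` setT) = xi B /\ lam (setT `*` B) = ups B].

Definition wasserstein (p : R) (xi ups : probability rvec R) : \bar R :=
  ereal_inf [set ((\int[lam]_z ((supdist z.1 z.2) `^ p)%:E) `^ p^-1)%E
            | lam in couplings xi ups].

Definition wasserstein_max (p : R) (eta zeta : law_family) : \bar R :=
  \big[Order.max/-oo%E]_(h : config) wasserstein p (eta h) (zeta h).

End jmdp.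

(* Main.v *)
(* The action values of the iterates satisfy Q_{k+1} = T Q_k for the optimality
   operator T of the marginal MDP, because marginal consistency makes Q_{k+1}
   depend on the marginals only and the policy is greedy. Hence Q_k converges
   geometrically to Q^*, and the positive gap forces G(eta_k) = pi^* from some K
   on. After that the iterates are (T^{pi^*})^n eta_K, which at h is the law of
   the first n discounted rewards of the branch from h plus gamma^n Z', with Z'
   drawn from eta_K(h^(n)). Coupling it with the full return of the same branch
   costs at most gamma^n (|Z'| + 1/(1-gamma)), so W_p decays like gamma^n. *)

Require Import Defs.
From HB Require Import structures.
From mathcomp Require Import all_boot all_order all_algebra.
From mathcomp Require Import all_classical all_reals all_analysis.
From mathcomp Require Import measurable_realfun giry ring lra.

Set Implicit Arguments.
Unset Strict Implicit.
Unset Printing Implicit Defensive.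

Import Order.TTheory GRing.Theory Num.Theory.
Import numFieldNormedType.Exports.

Local Open Scope classical_set_scope.
Local Open Scope ring_scope.

(** * Integration against mixtures and marginals of finite products *)

Section mixture_integral.
Context d1 d2 (T1 : measurableType d1) (T2 : measurableType d2) (R : realType).
Variables (P : probability T1 R) (k : T1 -> probability T2 R).
Hypothesis mk : forall B, measurable B -> measurable_fun setT (fun x => k x B).

(** The mixture is the bind of the Giry monad, so the formula is [giry_int_bind] once the two
    measures are identified on measurable sets. *)
Lemma ge0_integral_mixture (f : T2 -> \bar R) :
  measurable_fun setT f -> (forall y, 0 <= f y)%E ->
  (\int[mixture P mk]_y f y = \int[P]_x \int[k x]_y f y)%E.
Proof.
move=> mf f0.
have mk' : measurable_fun setT (k : T1 -> giry T2 R).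
  exact: measurable_giry_codensity.
rewrite -[RHS](giry_int_bind P mk' mf f0).
apply: eq_measure_integral => B mB _.
rewrite [RHS](giry_int_map mk')//; exact: measurable_giry_ev.
Qed.

End mixture_integral.

(** Induction on [l]: at each stage the event is a rectangle with one full side, and that side has
    mass 1. The values [i0] and [x0] are defaults of [nth], never reached since [j < size l]. *)
Lemma seq_prod_marginal d (T : measurableType d) (R : realType) (I : Type)
    (mu : I -> probability T R) (l : seq I) (i0 : I) (x0 : T) j (B : set T) :
  (j < size l)%N -> measurable B ->
  seq_prod mu l [set x : (size l).-tuple T | B (nth x0 x j)] =
  mu (nth i0 l j) B.
Proof.
elim: l j => [//|i l IHl] [_|j jl] mB /=.
- rewrite /distribution /pushforward /= /prod_prob.
  rewrite (_ : _ @^-1` _ = B `*` setT); last first.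
    by apply/seteqP; split => [[a b]|[a b] []]//=.
  by rewrite product_measure1E// [X in (_ * X)%E]probability_setT mule1.
- rewrite /distribution /pushforward /= /prod_prob.
    rewrite (_ : _ @^-1` _ =
      setT `*` [set x : (size l).-tuple T | B (nth x0 x j)]); last first.
    by apply/seteqP; split => [[a b]|[a b] []]//=.
  rewrite product_measure1E//; last first.
    pose f (x : (size l).-tuple T) := tnth x (Ordinal (jl : (j < size l)%N)).
    rewrite -[X in measurable X]setTI.
    rewrite (_ : [set x | _] = f @^-1` B); first exact: measurable_tnth.
    by apply/seteqP; split => x /=; rewrite /f (tnth_nth x0).
  by rewrite [X in (X * _)%E]probability_setT mul1e; exact: IHl.
Qed.

(** * Single coordinates of the sampled outcomes *)

Section outcomes.
Context (R : realType) (S : finPointedType) (A : finType).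
Implicit Types (J : JMDP R S A) (h : config S A) (i : 'I_#|A|).

(** Coordinate [i] reads only the table drawn at the state of [h i], so its law depends on [h]
    through [h i] alone. This is the source of marginal consistency for the operator. *)
Lemma outcome_law_marginal J h i (B : set (R * discrete_space S)) :
  measurable B ->
  outcome_law J h [set o | B (tnth o i)] =
  table_law J (h i).1 [set o | B (tnth o (enum_rank (h i).2))].
Proof.
move=> mB.
have hi : (h i).1 \in distinct_states h.
  by rewrite mem_undup; apply/mapP; exists i; rewrite ?mem_enum.
rewrite /outcome_law /distribution /pushforward /=.
have jl : (index (h i).1 (distinct_states h) < size (distinct_states h))%N.
  by rewrite index_mem.
have mB' : measurable [set o : outcome R S A | B (tnth o (enum_rank (h i).2))].
  by rewrite -[X in measurable X]setTI; exact: measurable_tnth.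
have := seq_prod_marginal (table_law J) (h i).1 point jl mB'.
rewrite nth_index// => <-; congr (seq_prod _ _ _).
by apply/seteqP; split => x /=; rewrite tnth_mktuple.
Qed.

Lemma ge0_integral_outcome_coordinate J h i
    (f : R * discrete_space S -> \bar R) :
  measurable_fun setT f -> (forall x, 0 <= f x)%E ->
  (\int[outcome_law J h]_o f (tnth o i) =
   \int[table_law J (h i).1]_o f (tnth o (enum_rank (h i).2)))%E.
Proof.
move=> mf f0.
pose j := enum_rank (h i).2.
rewrite -[LHS](ge0_integral_pushforward (measurable_tnth i) (outcome_law J h)
  measurableT)//.
rewrite -[RHS](ge0_integral_pushforward (measurable_tnth j)
  (table_law J (h i).1) measurableT)//.
apply: eq_measure_integral; [exact: measurable_tnth|exact: measurable_tnth|].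
by move=> ? ? B mB _; exact: outcome_law_marginal.
Qed.

Lemma integral_outcome_coordinate J h i (f : R * discrete_space S -> \bar R) :
  measurable_fun setT f ->
  (\int[outcome_law J h]_o f (tnth o i) =
   \int[table_law J (h i).1]_o f (tnth o (enum_rank (h i).2)))%E.
Proof.
move=> mf; pose proj j (o : outcome R S A) := tnth o j.
rewrite [LHS]integralE [RHS]integralE.
rewrite (funepos_comp f (proj i)) (funeneg_comp f (proj i)).
rewrite (funepos_comp f (proj (enum_rank (h i).2))).
rewrite (funeneg_comp f (proj (enum_rank (h i).2))).
congr (_ - _)%E; apply: ge0_integral_outcome_coordinate => //.
  exact: measurable_funepos.
exact: measurable_funeneg.
Qed.

End outcomes.

(** * Moments of the sup norm *)

Section supnorm.
Context (R : realType) (A : finType).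
Implicit Types (z : rvec R A) (p c s : R).

Lemma supnorm_ge0 z : 0 <= supnorm z.
Proof. exact: bigmax_ge_id. Qed.

Lemma le_supnorm z i : `|tnth z i| <= supnorm z.
Proof. exact: (le_bigmax _ (fun i => `|tnth z i|)). Qed.

Lemma supnorm_le z c : 0 <= c -> (forall i, `|tnth z i| <= c) -> supnorm z <= c.
Proof. by move=> c0 zc; apply: bigmax_le. Qed.

Lemma measurable_supnorm : measurable_fun setT (@supnorm R A).
Proof.
rewrite /supnorm; elim: (index_enum _) => [|i l IHl].
  by under eq_fun do rewrite big_nil; exact: measurable_cst.
under eq_fun do rewrite big_cons.
apply: measurable_maxr => //.
by apply: measurableT_comp => //; exact: measurable_tnth.
Qed.

(** By symmetry [c <= s], and then [c + s <= 2 * s]. The constant is crude, but only finiteness of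
    moments depends on it. *)
Lemma powRD_le p c s : 0 <= p -> 0 <= c -> 0 <= s ->
  (c + s) `^ p <= 2 `^ p * (c `^ p + s `^ p).
Proof.
move=> p0; wlog cs : c s / c <= s.
  move=> wlg c0 s0; have [cs|/ltW sc] := leP c s; first exact: wlg.
  by rewrite addrC [X in _ * X]addrC; exact: wlg.
move=> c0 s0; apply: (@le_trans _ _ ((2 * s) `^ p)).
  apply: ge0_ler_powR; rewrite ?nnegrE ?addr_ge0 ?mulr_ge0//.
  by rewrite mulr2n mulrDl mul1r lerD2r.
by rewrite powRM// ler_wpM2l ?powR_ge0// lerDr powR_ge0.
Qed.

Lemma measurable_shifted_moment p c :
  measurable_fun setT (fun z : rvec R A => ((c + supnorm z) `^ p)%:E).
Proof.
apply/measurable_EFinP.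
apply: (measurableT_comp (@measurable_powR R p)).
by apply: measurable_funD => //; exact: measurable_supnorm.
Qed.

(** The shift [c] will be 1 when one reward is added, and [1 / (1 - gamma)] when a whole discounted
    tail is. *)
Lemma shifted_moment_lty p c (xi : probability (rvec R A) R) :
  0 <= p -> 0 <= c -> finite_moment p xi ->
  (\int[xi]_z ((c + supnorm z) `^ p)%:E < +oo)%E.
Proof.
move=> p0 c0; rewrite /finite_moment => xip.
have mp : measurable_fun setT (fun z : rvec R A => ((supnorm z) `^ p)%:E).
  under eq_fun do rewrite -[supnorm _]add0r.
  exact: measurable_shifted_moment.
apply: (@le_lt_trans _ _
  (\int[xi]_z ((2 `^ p)%:E * ((c `^ p)%:E + ((supnorm z) `^ p)%:E)))%E).
  apply: ge0_le_integral => //.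
  - by move=> z _; rewrite lee_fin powR_ge0.
  - exact: measurable_shifted_moment.
  - by apply: measurable_funeM; apply: emeasurable_funD.
  - by move=> z _; rewrite -EFinD -EFinM lee_fin powRD_le// supnorm_ge0.
rewrite ge0_integralZl//; last 2 first.
- exact: emeasurable_funD.
- by move=> z _; rewrite adde_ge0// lee_fin powR_ge0.
apply: lte_mul_pinfty; rewrite ?lee_fin ?powR_ge0//.
rewrite ge0_integralD//; last 2 first.
- by move=> z _; rewrite lee_fin powR_ge0.
- by move=> z _; rewrite lee_fin powR_ge0.
rewrite lte_add_pinfty// integral_cst// [X in (_ * X)%E]probability_setT mule1.
by rewrite ltry.
Qed.

(** The dominating function is [(1 + supnorm z) ^ p]: its base is at least 1, so the power [p >= 1]
    only increases it. *)
Lemma integrable_coordinate p (xi : probability (rvec R A) R) i :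
  1 <= p -> finite_moment p xi ->
  xi.-integrable setT (fun z => (tnth z i)%:E).
Proof.
move=> p1 xip; have p0 : 0 <= p by rewrite (le_trans _ p1).
have mi : measurable_fun setT (fun z : rvec R A => (tnth z i)%:E).
  by apply/measurable_EFinP; exact: measurable_tnth.
apply/integrableP; split => //.
apply: le_lt_trans (shifted_moment_lty p0 ler01 xip).
apply: ge0_le_integral => //.
- exact: measurableT_comp.
- exact: measurable_shifted_moment.
- move=> z _; rewrite lee_fin (le_trans (le_supnorm _ _))//.
  rewrite (@le_trans _ _ (1 + supnorm z)) ?lerDr//.
  by rewrite le1r_powR// lerDl supnorm_ge0.
Qed.

End supnorm.

(** * Integration against the fixed-policy operator *)

Section operator.
Context (R : realType) (S : finPointedType) (A : finType) (J : JMDP R S A).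
Implicit Types (h k : config S A) (i : 'I_#|A|) (eta : law_family R S A).

Lemma measurable_reward_itv :
  measurable [set o : outcome R S A | forall i, 0 <= reward o i <= 1].
Proof.
rewrite (_ : [set _ | _] = \bigcap_(i in [set: 'I_#|A|])
    [set o : outcome R S A | 0 <= reward o i <= 1]); last first.
  by apply/seteqP; split => o /= H i => [_|]; exact: H.
apply: fin_bigcap_measurable => [|i _]; first exact: finite_finset.
rewrite -[X in measurable X]setTI.
rewrite (_ : [set _ | _] = (@reward R S A)^~ i @^-1` `[0, 1]%classic).
  exact: measurable_reward.
by apply/seteqP; split => o /=; rewrite in_itv.
Qed.

Lemma table_reward_itv_ae s i :
  \forall o \ae table_law J s, 0 <= reward o i <= 1.
Proof.
exists (~` [set o : outcome R S A | forall j, 0 <= reward o j <= 1]); split.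
- by apply: measurableC; exact: measurable_reward_itv.
- rewrite probability_setC; last exact: measurable_reward_itv.
  by rewrite table_reward_itv subee.
- by move=> o /= oN oall; apply: oN; exact: oall.
Qed.

(** For each of the finitely many coordinates the exceptional event concerns that coordinate only,
    so it is as unlikely as under a single table. *)
Lemma outcome_reward_itv_ae h :
  \forall o \ae outcome_law J h, forall i, 0 <= reward o i <= 1.
Proof.
apply: filter_forall => i.
have mB : measurable [set x : R * discrete_space S | ~ 0 <= x.1 <= 1].
  rewrite -[X in measurable X]setTI.
  rewrite (_ : [set _ | _] = fst @^-1` ~` `[0, 1]%classic); last first.
    by apply/seteqP; split => o /=; rewrite in_itv.
  by apply: measurable_fst => //; exact: measurableC.
have mN j : measurable (~` [set o : outcome R S A | 0 <= reward o j <= 1]).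
  rewrite -[X in measurable X]setTI.
  have := measurable_tnth j measurableT mB.
  by congr measurable; apply/seteqP; split.
have /negligibleP := table_reward_itv_ae (h i).1 (enum_rank (h i).2).
move=> /(_ (mN _)) N0; apply/negligibleP => //.
by rewrite -[RHS]N0; exact: (outcome_law_marginal J h i mB).
Qed.

Lemma ge0_integral_policy_operator pi eta h (f : rvec R A -> \bar R) :
  measurable_fun setT f -> (forall z, 0 <= f z)%E ->
  (\int[policy_operator J pi eta h]_z f z =
   \int[outcome_law J h]_o
     \int[eta (next_config pi o)]_z f (backup (discount J) o z))%E.
Proof.
move=> mf f0; rewrite [LHS]ge0_integral_mixture//; apply: eq_integral => o _.
exact: ge0_integral_distribution.
Qed.

Lemma measurable_backup_integral pi eta (f : rvec R A -> \bar R) :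
  measurable_fun setT f -> (forall z, 0 <= f z)%E ->
  measurable_fun setT (fun o =>
    \int[eta (next_config pi o)]_z f (backup (discount J) o z))%E.
Proof.
move=> mf f0.
rewrite (_ : (fun _ => _) = (fun o => \int[backup_law J pi eta o]_z f z)%E).
  apply: measurable_fun_integral_kernel => //.
  exact: measurable_backup_law.
by apply/funext => o; apply/esym; exact: ge0_integral_distribution.
Qed.

(** The nonnegative case is applied to the positive and negative parts; integrability of [f] makes
    both outer integrands integrable, so that their difference can be taken under the integral. *)
Lemma integral_policy_operator pi eta h (f : rvec R A -> \bar R) :
  (policy_operator J pi eta h).-integrable setT f ->
  (\int[policy_operator J pi eta h]_z f z =
   \int[outcome_law J h]_o
     \int[eta (next_config pi o)]_z f (backup (discount J) o z))%E.
Proof.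
move=> fi.
have mf := measurable_int _ fi.
have mp := measurable_funepos mf; have mn := measurable_funeneg mf.
rewrite [LHS]integralE !ge0_integral_policy_operator//.
have mI := @measurable_backup_integral pi eta.
rewrite -integralB//; last 2 first.
- apply/integrableP; split; first exact: mI.
  under eq_integral do rewrite gee0_abs ?integral_ge0//.
  rewrite -ge0_integral_policy_operator//.
  by have /integrableP[_] := integrable_funepos measurableT fi;
    under eq_integral do rewrite gee0_abs//.
- apply/integrableP; split; first exact: mI.
  under eq_integral do rewrite gee0_abs ?integral_ge0//.
  rewrite -ge0_integral_policy_operator//.
  by have /integrableP[_] := integrable_funeneg measurableT fi;
    under eq_integral do rewrite gee0_abs//.
apply: eq_integral => o _ /=; rewrite [RHS]integralE.
rewrite (funepos_comp f (backup (discount J) o)).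
by rewrite (funeneg_comp f (backup (discount J) o)).
Qed.

End operator.

(** As [c] takes finitely many values, the preimage is a finite union over [i] of the fiber of [c]
    intersected with a set where the kernel [Q i] is fixed; there it is measurability of the measure
    of sections. *)
Lemma measurable_finite_kernel d1 d2 d3 (W : measurableType d1)
    (V : measurableType d2) (Y : measurableType d3) (R : realType)
    (I : finType) (c : W -> I) (Q : I -> probability V R) (F : W * V -> Y)
    (B : set Y) :
  (forall i, measurable [set w | c w = i]) -> measurable_fun setT F ->
  measurable B ->
  measurable_fun setT (fun w => Q (c w) [set v | B (F (w, v))]).
Proof.
move=> mc mF mB _ X mX; rewrite setTI.
have mE : measurable (F @^-1` B) by rewrite -[_ @^-1` _]setTI; exact: mF.
have sectionE w : [set v | B (F (w, v))] = xsection (F @^-1` B) w.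
  by apply/seteqP; split => v; rewrite /xsection /= inE.
rewrite (_ : _ @^-1` _ = \bigcup_(i in [set: I])
   ([set w | c w = i] `&` (fun w => Q i (xsection (F @^-1` B) w)) @^-1` X)).
  apply: fin_bigcup_measurable => [|i _]; first exact: finite_finset.
  apply: measurableI; first exact: mc.
  rewrite -[_ @^-1` _]setTI; exact: measurable_fun_xsection.
apply/seteqP; split => w /=.
  by move=> Xw; exists (c w) => //; split => //=; rewrite -sectionE.
by case=> i _ [/= <-]; rewrite sectionE.
Qed.

(** * The operator preserves moments and marginal consistency *)

Section operator_preservation.
Context (R : realType) (S : finPointedType) (A : finType) (J : JMDP R S A).
Implicit Types (h k : config S A) (i : 'I_#|A|) (eta : law_family R S A).
Implicit Types (p c : R) (pi : S -> A).

Let gamma_ge0 : 0 <= discount J.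
Proof. by have /andP[/ltW] := discount_itv J. Qed.

Let gamma_le1 : discount J <= 1.
Proof. by have /andP[_ /ltW] := discount_itv J. Qed.

(** There are finitely many configurations, so the sum of their moments bounds each of them. *)
Lemma uniform_shifted_moment p c eta : 0 <= p -> 0 <= c ->
  (forall k, finite_moment p (eta k)) ->
  exists2 C : R, 0 <= C &
    forall k, (\int[eta k]_z ((c + supnorm z) `^ p)%:E <= C%:E)%E.
Proof.
move=> p0 c0 etap.
pose I k := (\int[eta k]_z ((c + supnorm z) `^ p)%:E)%E.
have I0 k : (0 <= I k)%E.
  by apply: integral_ge0 => z _; rewrite lee_fin powR_ge0.
have Ifin k : I k \is a fin_num.
  by rewrite ge0_fin_numE//; exact: shifted_moment_lty.
exists (\sum_k fine (I k)); first by apply: sumr_ge0 => k _; exact: fine_ge0.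
move=> k; rewrite -[leLHS]fineK; last exact: Ifin.
rewrite lee_fin (bigD1 k)//= lerDl.
by apply: sumr_ge0 => k' _; exact: fine_ge0.
Qed.

Lemma supnorm_backup_le o (z : rvec R A) :
  (forall i, 0 <= reward o i <= 1) ->
  supnorm (backup (discount J) (o : outcome R S A) z) <= 1 + supnorm z.
Proof.
move=> o01; apply: supnorm_le => [|i].
  by rewrite addr_ge0 ?supnorm_ge0.
have /andP[r0 r1] := o01 i.
rewrite tnth_mktuple (le_trans (ler_normD _ _))// lerD//.
  by rewrite ger0_norm.
rewrite normrM ger0_norm// (le_trans _ (le_supnorm z i))//.
by rewrite ler_piMl.
Qed.

(** A backup raises the sup norm by at most 1 almost surely, and the moments shifted by 1 are
    bounded uniformly over the next configurations. *)
Lemma finite_moment_policy_operator p pi eta h : 0 <= p ->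
  (forall k, finite_moment p (eta k)) ->
  finite_moment p (policy_operator J pi eta h).
Proof.
move=> p0 etap; rewrite /finite_moment.
have [C C0 etaC] := uniform_shifted_moment p0 ler01 etap.
have mp : measurable_fun setT (fun z : rvec R A => ((supnorm z) `^ p)%:E).
  under eq_fun do rewrite -[supnorm _]add0r.
  exact: measurable_shifted_moment.
rewrite ge0_integral_policy_operator//; last first.
  by move=> z; rewrite lee_fin powR_ge0.
apply: (@le_lt_trans _ _ (\int[outcome_law J h]_o C%:E)%E).
  apply: ae_ge0_le_integral => //.
  - by move=> o _; apply: integral_ge0 => z _; rewrite lee_fin powR_ge0.
  - apply: (measurable_backup_integral J pi eta mp) => z.
    by rewrite lee_fin powR_ge0.
  - apply: filterS (outcome_reward_itv_ae J h) => o o01 _.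
    apply: (le_trans _ (etaC (next_config pi o))).
    apply: ge0_le_integral => //.
    + by move=> z _; rewrite lee_fin powR_ge0.
    + exact: (measurableT_comp mp (measurable_backup _ _)).
    + exact: measurable_shifted_moment.
    + move=> z _; rewrite lee_fin; apply: ge0_ler_powR => //.
      * by rewrite nnegrE supnorm_ge0.
      * by rewrite nnegrE addr_ge0 ?supnorm_ge0.
      * exact: supnorm_backup_le.
by rewrite integral_cst// [X in (_ * X)%E]probability_setT mule1 ltry.
Qed.

Lemma marginal_coordinate eta k i (B : set R) : marginally_consistent eta ->
  measurable B ->
  eta k [set z | B (tnth z i)] = marginal eta (k i).1 (k i).2 B.
Proof.
move=> etac mB; apply: (etac k (diag_config A (k i).1) i) => //.
by rewrite ffunE enum_rankK; case: (k i).
Qed.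

(** The law of coordinate [l] at [k] is computed from one coordinate of one table and from the
    marginals of [eta], hence from [k l] only. *)
Lemma marginally_consistent_policy_operator pi eta :
  marginally_consistent eta -> marginally_consistent (policy_operator J pi eta).
Proof.
move=> etac h h' i j hh' B mB.
(* [G x] is the conditional probability of [B] given the reward and the successor in [x]. *)
pose G (x : R * discrete_space S) :=
  marginal eta x.2 (pi x.2) [set z | B (x.1 + discount J * z)].
have G0 x : (0 <= G x)%E by exact: measure_ge0.
have mG : measurable_fun setT G.
  apply: (@measurable_finite_kernel _ _ _ (R * discrete_space S)%type R R R S
    (fun x => x.2) (fun s => marginal eta s (pi s))
    (fun y => y.1.1 + discount J * y.2) B) => //.
    move=> s; rewrite -[X in measurable X]setTI.
    exact: (@measurable_snd _ _ R (discrete_space S) measurableT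
      [set s : discrete_space S]).
  apply: measurable_funD.
    exact: (measurableT_comp measurable_fst measurable_fst).
  by apply: measurable_funM => //; exact: measurable_snd.
have lawE (k : config S A) l :
    distribution (policy_operator J pi eta k) (coordinate l) B =
    (\int[table_law J (k l).1]_o G (tnth o (enum_rank (k l).2)))%E.
  rewrite -ge0_integral_outcome_coordinate//.
  apply: eq_integral => o _.
  rewrite /backup_law /distribution /pushforward.
  pose C := [set z | B (reward o l + discount J * z)].
  have mC : measurable C.
    have mf : measurable_fun setT (fun z => reward o l + discount J * z).
      by apply: measurable_funD => //; exact: measurable_funM.
    by rewrite -[C]setTI; exact: mf.
  transitivity (eta (next_config pi o) [set z | C (tnth z l)]).
    congr (eta _ _).
    by apply/seteqP; split => z /=; rewrite /coordinate tnth_mktuple.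
  by rewrite (marginal_coordinate _ _ etac mC) ffunE.
by rewrite !lawE hh'.
Qed.

Lemma consistent_policy_operator p pi eta : 0 <= p ->
  consistent_family p eta -> consistent_family p (policy_operator J pi eta).
Proof.
move=> p0 [etap etac]; split.
  by move=> h; exact: finite_moment_policy_operator.
exact: marginally_consistent_policy_operator.
Qed.

End operator_preservation.

(** * Action values of a family and their Bellman equation *)

Section action_values.
Context (R : realType) (S : finPointedType) (A : finType) (J : JMDP R S A).
Implicit Types (h k : config S A) (i : 'I_#|A|) (eta : law_family R S A).
Implicit Types (p c e : R) (pi : S -> A) (w : S -> R).

Let gamma_ge0 : 0 <= discount J.
Proof. by have /andP[/ltW] := discount_itv J. Qed.

(** [Qmean] is defined at the configurations [h_s]; marginal consistency carries it to every
    configuration. *)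
Lemma integral_coordinate p eta k i : 1 <= p -> consistent_family p eta ->
  (\int[eta k]_z (tnth z i)%:E = (Qmean eta (k i).1 (k i).2)%:E)%E.
Proof.
move=> p1 [etap etac].
have ii := integrable_coordinate i p1 (etap k).
have mE : measurable_fun setT (EFin : R -> \bar R) by exact/measurable_EFinP.
have marginalE : (\int[marginal eta (k i).1 (k i).2]_x x%:E =
    \int[eta k]_z (tnth z i)%:E)%E.
  rewrite -[RHS](integral_distribution (X := coordinate i) mE ii).
  apply: eq_measure_integral => B mB _.
  by apply/esym; exact: marginal_coordinate.
rewrite /Qmean /Rintegral marginalE fineK//.
exact: integrable_fin_num.
Qed.

Lemma integrable_reward s i :
  (table_law J s).-integrable setT (fun o => (reward o i)%:E).
Proof.
have mi : measurable_fun setT (fun o : outcome R S A => (reward o i)%:E).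
  by apply/measurable_EFinP; exact: measurable_reward.
apply/integrableP; split => //.
apply: (@le_lt_trans _ _ (\int[table_law J s]_o 1%E)%E).
  apply: ae_ge0_le_integral => //; first exact: measurableT_comp.
  apply: filterS (table_reward_itv_ae J s i) => o /andP[r0 r1] _.
  by rewrite /= lee_fin ger0_norm.
by rewrite integral_cst// [X in (_ * X)%E]probability_setT mule1 ltry.
Qed.

Lemma measurable_value_successor i w :
  measurable_fun setT (fun o : outcome R S A => w (successor o i)).
Proof.
have mw : measurable_fun setT (w : discrete_space S -> R) by [].
exact: (measurableT_comp mw (measurable_successor i)).
Qed.

Lemma integrable_one_step s i w :
  (table_law J s).-integrable setT
    (fun o => (reward o i + discount J * w (successor o i))%:E).
Proof.
under eq_fun do rewrite EFinD.
apply: integrableD => //; first exact: integrable_reward.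
apply: measurable_bounded_integrable => //.
- by rewrite [ltLHS]probability_setT ltry.
- apply: measurable_funM => //; exact: measurable_value_successor.
(* The sum over all states dominates the term of the successor, whichever state it is. *)
exists (\sum_s `|discount J * w s|); split; first exact: num_real.
move=> x xM o _; rewrite /= (le_trans _ (ltW xM))//.
by rewrite (bigD1 (successor o i))//= lerDl sumr_ge0.
Qed.

(** The two backups share the reward, which cancels in the difference; only the discounted
    difference of the successor values remains. *)
Lemma one_step_dist s i w1 w2 q1 q2 e : 
  q1%:E = (\int[table_law J s]_o
    (reward o i + discount J * w1 (successor o i))%:E)%E ->
  q2%:E = (\int[table_law J s]_o
    (reward o i + discount J * w2 (successor o i))%:E)%E ->
  (forall s', `|w1 s' - w2 s'| <= e) -> `|q1 - q2| <= discount J * e.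
Proof.
move=> q1E q2E w12.
have qB : (q1 - q2)%:E = (\int[table_law J s]_o
    (discount J * (w1 (successor o i) - w2 (successor o i)))%:E)%E.
  rewrite EFinB q1E q2E -integralB_EFin//; [|exact: integrable_one_step..].
  by apply: eq_integral => o _; rewrite -EFinB; congr EFin; ring.
have mw : measurable_fun setT (fun o : outcome R S A =>
    (discount J * (w1 (successor o i) - w2 (successor o i)))%:E).
  apply/measurable_EFinP; apply: measurable_funM => //.
  by apply: measurable_funB; exact: measurable_value_successor.
rewrite -lee_fin -abse_EFin qB.
apply: (le_trans (le_abse_integral _ _ _)) => //.
apply: (@le_trans _ _ (\int[table_law J s]_o (discount J * e)%:E)%E).
  apply: ge0_le_integral => //.
  - exact: measurableT_comp.
  - by move=> o _; rewrite /= lee_fin normrM ger0_norm// ler_wpM2l.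
by rewrite integral_cst// [X in (_ * X)%E]probability_setT mule1.
Qed.

(** Bellman equation for the means: given the outcome, the inner mean is affine in a coordinate at
    the next configuration, and its value there is a [Qmean] of [eta]. *)
Lemma Qmean_policy_operator p pi eta s a : 1 <= p -> consistent_family p eta ->
  (Qmean (policy_operator J pi eta) s a)%:E =
  (\int[table_law J s]_o (reward o (enum_rank a) + discount J *
     Qmean eta (successor o (enum_rank a))
       (pi (successor o (enum_rank a))))%:E)%E.
Proof.
move=> p1 etac; have p0 : 0 <= p by rewrite (le_trans _ p1).
have Tetac := consistent_policy_operator J pi p0 etac.
pose h := diag_config A s; pose i := enum_rank a.
have hi : h i = (s, a) by rewrite ffunE enum_rankK.
pose g (x : R * discrete_space S) :=
  (x.1 + discount J * Qmean eta x.2 (pi x.2))%:E.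
have mg : measurable_fun setT g.
  have mw : measurable_fun setT
    ((fun s' => Qmean eta s' (pi s')) : discrete_space S -> R) by [].
  apply/measurable_EFinP; apply: measurable_funD => //.
  apply: measurable_funM => //.
  exact: (measurableT_comp mw measurable_snd).
have := integral_coordinate h i p1 Tetac.
rewrite hi /= => <-.
rewrite integral_policy_operator; last first.
  by apply: integrable_coordinate p1 _; case: Tetac.
transitivity (\int[outcome_law J h]_o g (tnth o i))%E.
  apply: eq_integral => o _.
  have ii := integrable_coordinate i p1 (etac.1 (next_config pi o)).
  under eq_integral do rewrite tnth_mktuple EFinD EFinM.
  rewrite integralD//; last 2 first.
  - exact: finite_measure_integrable_cst.
  - exact: integrableZl.
  rewrite integral_cst// [X in (_ * X)%E]probability_setT mule1.
  rewrite integralZl// (integral_coordinate _ _ p1 etac).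
  by rewrite ffunE /= -EFinM -EFinD.
by rewrite integral_outcome_coordinate// hi.
Qed.

End action_values.

(** * Value iteration and identification of the optimal policy *)

Section greedy_iteration.
Context (R : realType) (S : finPointedType) (A : finType) (J : JMDP R S A).
Variables (Qstar : S -> A -> R) (pistar : S -> A) (p : R).
Variables (G : law_family R S A -> S -> A) (eta0 : law_family R S A).
Hypotheses (Qstar_optimal : is_optimal_Q J Qstar)
  (unique_optimal : forall s, argmax (Qstar s) = [set pistar s])
  (p_ge1 : 1 <= p)
  (G_greedy : forall eta, consistent_family p eta ->
     forall s, argmax (Qmean eta s) (G eta s))
  (eta0_consistent : consistent_family p eta0).

Let eta_ k := iter k (greedy_operator J G) eta0.

Let pistar_max s b : Qstar s b <= Qstar s (pistar s).
Proof. by have : argmax (Qstar s) (pistar s) by rewrite unique_optimal. Qed.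

Lemma greedy_iter_consistent k : consistent_family p (eta_ k).
Proof.
elim: k => [//|k IHk]; apply: consistent_policy_operator => //.
by rewrite (le_trans _ p_ge1).
Qed.

Lemma greedy_value_dist eta e : consistent_family p eta ->
  (forall s a, `|Qmean eta s a - Qstar s a| <= e) ->
  forall s a,
    `|Qmean (greedy_operator J G eta) s a - Qstar s a| <= discount J * e.
Proof.
move=> etac etae s a.
apply: (@one_step_dist _ _ _ J s (enum_rank a)
  (fun s' => Qmean eta s' (G eta s')) (fun s' => Qstar s' (pistar s'))).
- exact: Qmean_policy_operator p_ge1 etac.
- rewrite Qstar_optimal unlock; apply: eq_integral => o _.
  (* The maximum over the actions is attained at [pistar]. *)
  congr (_ + _ * _)%:E; apply/le_anti/andP; split.
    by apply: bigmax_le => // b _.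
  exact: (le_bigmax _ (Qstar (successor o (enum_rank a)))).
- move=> s'.
  (* Two maxima are compared, each tested at the maximiser of the other, so they differ by at most
     [e] even when the maximisers differ. *)
  have := etae s' (G eta s'); have := etae s' (pistar s').
  have := G_greedy etac s' (pistar s'); have := pistar_max s' (G eta s').
  rewrite !ler_norml => Hq HG /andP[? ?] /andP[? ?]; apply/andP; split; lra.
Qed.

(** Each step contracts the error by [discount J]; the double sum is an initial bound common to all
    state-action pairs. *)
Lemma greedy_iter_value_dist k s a :
  `|Qmean (eta_ k) s a - Qstar s a| <=
  discount J ^+ k * \sum_s \sum_a `|Qmean eta0 s a - Qstar s a|.
Proof.
elim: k s a => [s a|k IHk s a].
  rewrite expr0 mul1r (bigD1 s)//= (bigD1 a)//= -addrA lerDl addr_ge0//.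
    exact: sumr_ge0.
  by apply: sumr_ge0 => s' _; exact: sumr_ge0.
rewrite exprS -mulrA; apply: greedy_value_dist => //.
exact: greedy_iter_consistent.
Qed.

(** Stated pair by pair, the claim is that each suboptimal action eventually ceases to be greedy.
    There are finitely many pairs, so one threshold serves them all. *)
Lemma eventually_greedy_optimal : \forall k \near \oo, G (eta_ k) = pistar.
Proof.
suff : \forall k \near \oo, forall sb : S * A,
    G (eta_ k) sb.1 = sb.2 -> sb.2 = pistar sb.1.
  by apply: filterS => k Gk; apply/funext => s; exact: (Gk (s, _) erefl).
apply: filter_forall => -[s b] /=.
have [->|b_neq] := eqVneq b (pistar s); first exact: nearW.
pose M := \sum_s \sum_a `|Qmean eta0 s a - Qstar s a|.
have b_lt : Qstar s b < Qstar s (pistar s).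
  rewrite lt_neqAle pistar_max andbT; apply: contra b_neq => /eqP bE.
  have : argmax (Qstar s) b by move=> c; rewrite bE.
  by rewrite unique_optimal => ->.
(* Half the gap: errors below [delta] at [b] and at [pistar s] cannot together reverse their
   order. *)
pose delta := (Qstar s (pistar s) - Qstar s b) / 2.
have delta_gt0 : 0 < delta by rewrite divr_gt0// subr_gt0.
have cvg0 : (fun k => discount J ^+ k * M) @ \oo --> 0.
  rewrite -[X in _ --> X](mul0r M); apply: cvgMl; apply: cvg_expr.
  by have /andP[g0 g1] := discount_itv J; rewrite ger0_norm ?ltW.
have /cvgr0_norm_lt/(_ _ delta_gt0) := cvg0.
apply: filterS => k kd Gk; exfalso.
have {kd} kd : discount J ^+ k * M < delta.
  by rewrite (le_lt_trans (ler_norm _)).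
have := G_greedy (greedy_iter_consistent k) s (pistar s); rewrite Gk.
have := greedy_iter_value_dist k s b.
have := greedy_iter_value_dist k s (pistar s).
rewrite -/M !ler_norml => /andP[? ?] /andP[? ?] ?.
rewrite /delta in kd; lra.
Qed.

End greedy_iteration.

(** * Laws with a second draw depending on a finite-valued function *)

Section randomized_law.
Context d1 d2 d3 (W : measurableType d1) (V : measurableType d2)
  (Y : measurableType d3) (R : realType) (I : finType).
Variables (P : probability W R) (c : W -> I) (Q : I -> probability V R).
Variable F : W * V -> Y.
Hypothesis mc : forall i, measurable [set w | c w = i].
Hypothesis mF : measurable_fun setT F.

(** The measurability proof is an argument so that the instance below can find it in the term. *)
Definition fiber of measurable_fun setT F := fun w v => F (w, v).

Lemma measurable_fiber w : measurable_fun setT (fiber mF w).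
Proof. exact: (measurableT_comp mF (pair1_measurable w)). Qed.

HB.instance Definition _ w :=
  isMeasurableFun.Build _ _ _ _ (fiber mF w) (measurable_fiber w).

Definition fiber_law w : probability Y R := distribution (Q (c w)) (fiber mF w).

Lemma measurable_fiber_law B : measurable B ->
  measurable_fun setT (fun w => fiber_law w B).
Proof. by move=> mB; exact: (measurable_finite_kernel Q mc mF mB). Qed.

(** The law of [F (w, v)] with [w] drawn from [P] and then [v] from [Q (c w)]. It serves both to
    prolong a branch by one step and to couple two returns. *)
Definition randomized_law : probability Y R := mixture P measurable_fiber_law.

Lemma randomized_lawE B :
  randomized_law B = (\int[P]_w Q (c w) [set v | B (F (w, v))])%E.
Proof. by []. Qed.

Lemma ge0_integral_randomized_law (f : Y -> \bar R) :
  measurable_fun setT f -> (forall y, 0 <= f y)%E ->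
  (\int[randomized_law]_y f y = \int[P]_w \int[Q (c w)]_v f (F (w, v)))%E.
Proof.
move=> mf f0; rewrite [LHS]ge0_integral_mixture//; apply: eq_integral => w _.
exact: ge0_integral_distribution.
Qed.

Lemma measurable_randomized_integral (f : Y -> \bar R) :
  measurable_fun setT f -> (forall y, 0 <= f y)%E ->
  measurable_fun setT (fun w => \int[Q (c w)]_v f (F (w, v)))%E.
Proof.
move=> mf f0; rewrite (_ : (fun _ => _) = fun w => \int[fiber_law w]_y f y)%E.
  by apply: measurable_fun_integral_kernel => //; exact: measurable_fiber_law.
by apply/funext => w; apply/esym; exact: ge0_integral_distribution.
Qed.

End randomized_law.

Lemma measure_fiber_sum d (W : measurableType d) (R : realType)
    (P : probability W R) (I : finType) (c : W -> I) (E : set W) :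
  (forall i, measurable [set w | c w = i]) -> measurable E ->
  P E = (\sum_(i : I) P [set w | c w = i /\ E w])%E.
Proof.
move=> mc mE.
have mEi i : measurable [set w | c w = i /\ E w].
  exact: (measurableI _ _ (mc i) mE).
transitivity (\int[P]_w \sum_(i : I) (\1_[set w | c w = i /\ E w] w)%:E)%E.
  rewrite -[in LHS](setIT E) -integral_indic//; apply: eq_integral => w _.
  rewrite (bigD1 (c w))//= big1 => [|i /eqP ic]; last first.
    by rewrite indicE memNset// => -[/esym].
  rewrite adde0 !indicE; congr ((_ : bool)%:R)%:E.
  by apply/idP/idP; rewrite !inE => //= -[].
rewrite ge0_integral_sum//; last by move=> i; apply/measurable_EFinP.
by apply: eq_bigr => i _; rewrite integral_indic// setIT.
Qed.

(** * Outcome paths up to a finite time *)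

Section path_space.
Context d (T : measurableType d) (n : nat).

(* Only the coordinates up to [n] are constrained, so that laws of sequences
   that agree on their first [n.+1] terms are equal on [path_space]. *)
Definition cylinder : set_system (nat -> T) :=
  [set C | exists2 B : nat -> set T, (forall u, measurable (B u)) &
           C = [set f | forall u, (u <= n)%N -> B u (f u)]].

Definition path_space : Type := g_sigma_algebraType cylinder.
HB.instance Definition _ := Measurable.on path_space.

Lemma cylinder_setI : setI_closed cylinder.
Proof.
move=> _ _ [B mB ->] [C mC ->]; exists (fun u => B u `&` C u).
  by move=> u; exact: measurableI.
apply/seteqP; split => f /=.
  by move=> [fB fC] u un; split; [exact: fB|exact: fC].
by move=> fBC; split => u un; have [] := fBC u un.
Qed.

Lemma cylinderT : cylinder setT.
Proof. by exists (fun _ => setT) => //; apply/seteqP; split. Qed.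

Lemma measurable_path_eval u : (u <= n)%N ->
  measurable_fun setT (fun f : path_space => f u).
Proof.
move=> un _ B mB; rewrite setTI; apply: sub_sigma_algebra.
exists (fun v => if v == u then B else setT) => [v|]; first by case: ifP.
apply/seteqP; split => f /=; first by move=> Bfu v _; case: eqP => [->|].
by move=> /(_ u un); rewrite eqxx.
Qed.

Lemma measurable_path d' (W : measurableType d') (g : nat -> W -> T) :
  (forall u, measurable_fun setT (g u)) ->
  measurable_fun setT (fun w => (g^~ w) : path_space).
Proof.
move=> mg.
apply: (@measurability _ _ W path_space setT (fun w => g^~ w) cylinder) => //=.
move=> _ [_ [B mB ->] <-].
rewrite setTI.
rewrite (_ : _ @^-1` _ = \bigcap_(u in [set u | (u <= n)%N]) (g u @^-1` B u)).
  apply: bigcap_measurable => [|u _]; first by exists 0%N.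
  by rewrite -[_ @^-1` _]setTI; exact: mg.
by apply/seteqP; split => w /=.
Qed.

(** Cylinders generate the sigma-algebra, are stable under intersection and include the whole space,
    so the uniqueness theorem for measures applies. *)
Lemma path_measure_unique (R : realType) (m1 m2 : probability path_space R) :
  (forall B : nat -> set T, (forall u, measurable (B u)) ->
    m1 [set f | forall u, (u <= n)%N -> B u (f u)] =
    m2 [set f | forall u, (u <= n)%N -> B u (f u)]) ->
  forall C, measurable C -> m1 C = m2 C.
Proof.
move=> m12 C mC.
apply: (@measure_unique _ R path_space cylinder (fun _ => setT)
  _ _ _ _ m1 m2) => //.
- exact: cylinder_setI.
- by move=> _; exact: cylinderT.
- by rewrite bigcup_const//; exists 0%N.
- by move=> _ [B mB ->]; exact: m12.
- by move=> _; rewrite [ltLHS]probability_setT ltry.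
Qed.

End path_space.

(** * Truncated returns along a path *)

Section path_return.
Context (R : realType) (S : finPointedType) (A : finType).
Variable gamma : R.

(** The return whose first [n] rewards are read along [f] and whose remainder, seen from time [n],
    is [z]. *)
Definition path_return (f : nat -> outcome R S A) n (z : rvec R A) : rvec R A :=
  [tuple series (fun t => gamma ^+ t * reward (f t) i) n + gamma ^+ n * tnth z i
  | i < #|A|].

Lemma measurable_path_return d (X : measurableType d)
    (g : nat -> X -> outcome R S A) n :
  (forall t, (t < n)%N -> measurable_fun setT (g t)) ->
  measurable_fun setT (fun x : X * rvec R A => path_return (g^~ x.1) n x.2).
Proof.
move=> mg; apply/measurable_fun_tnthP => i.
rewrite (_ : _ \o _ = fun x : X * rvec R A =>
    \sum_(t < n) gamma ^+ t * reward (g t x.1) i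
    + gamma ^+ n * coordinate i x.2); last first.
  by apply/funext => x /=; rewrite tnth_mktuple /series /= big_mkord.
apply: measurable_funD; last first.
  apply: measurable_funM => //.
  exact: (measurableT_comp (@measurable_coordinate _ _ i) measurable_snd).
apply: measurable_sum => t; apply: measurable_funM => //.
apply: (measurableT_comp (measurable_reward i)).
exact: (measurableT_comp (mg t (ltn_ord t)) measurable_fst).
Qed.

Lemma path_return0 f z : path_return f 0 z = z.
Proof.
apply: eq_from_tnth => i; rewrite tnth_mktuple /series /= big_geq//.
by rewrite add0r expr0 mul1r.
Qed.

(** The outcome at time [n] is absorbed into the remainder by one backup. Agreement of [f] and [g]
    before [n] is what a path resampled at time [n] satisfies. *)
Lemma path_returnS f g n z : (forall t, (t < n)%N -> f t = g t) ->
  path_return f n.+1 z = path_return g n (backup gamma (f n) z).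
Proof.
move=> fg; apply: eq_from_tnth => i; rewrite !tnth_mktuple /series /=.
rewrite big_nat_recr//= -addrA; congr (_ + _).
  by apply: eq_big_nat => t /andP[_ tn]; rewrite fg.
by rewrite exprSr mulrDr mulrA.
Qed.

End path_return.

(** * The branch process and iterates of the operator *)

Section branch.
Context (R : realType) (S : finPointedType) (A : finType) (J : JMDP R S A).
Context dW (W : measurableType dW) (P : probability W R).
Variables (pi : S -> A) (h : config S A) (o : nat -> W -> outcome R S A).
Hypothesis branch_o : branch_process J pi h P o.

Let mo t : measurable_fun setT (o t). Proof. exact: branch_o.1. Qed.

Lemma measurable_branch_config t k :
  measurable [set w | branch_config pi h o t w = k].
Proof.
case: t => [|t] /=.
  have [->|hk] := eqVneq h k.
    by rewrite (_ : [set _ | _] = setT)//; apply/seteqP; split.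
  rewrite (_ : [set _ | _] = set0)//; apply/seteqP; split => // w /= /eqP.
  by rewrite (negbTE hk).
rewrite -[X in measurable X]setTI.
exact: (mo t measurableT (measurable_next_config pi k)).
Qed.

(** The branch before time [n], then the new outcome. The path is constant from [n] on, but
    [path_space] at level [n] sees only its value at [n]. *)
Definition splice n (x : W * outcome R S A) : path_space (outcome R S A) n :=
  fun u => if (u < n)%N then o u x.1 else x.2.

Lemma measurable_splice n : measurable_fun setT (splice n).
Proof.
apply: (@measurable_path _ (outcome R S A) n _ (W * outcome R S A)%type
  (fun u x => if (u < n)%N then o u x.1 else x.2)) => u.
case: ltnP => _; last exact: measurable_snd.
exact: (measurableT_comp (mo u) measurable_fst).
Qed.

(** The outcome at time [n] may be redrawn from its conditional law. Both sides integrate [phi]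
    against laws on [path_space], which agree on cylinders by the defining property of the
    branch. *)
Lemma branch_one_step n (phi : path_space (outcome R S A) n -> \bar R) :
  measurable_fun setT phi -> (forall f, 0 <= phi f)%E ->
  (\int[P]_w phi (o^~ w) =
   \int[P]_w \int[outcome_law J (branch_config pi h o n w)]_x
     phi (splice n (w, x)))%E.
Proof.
move=> mphi phi0.
have mpath : measurable_fun setT
    (fun w => (o^~ w) : path_space (outcome R S A) n).
  exact: measurable_path.
pose path : {mfun W >-> path_space (outcome R S A) n} :=
  HB.pack (fun w => (o^~ w) : path_space (outcome R S A) n)
    (isMeasurableFun.Build _ _ _ _ _ mpath).
rewrite -(ge0_integral_randomized_law P (outcome_law J)
  (@measurable_branch_config n) (@measurable_splice n))//.
rewrite -(ge0_integral_distribution (P := P) path)//.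
apply: eq_measure_integral => C mC _; apply: path_measure_unique mC => B mB.
pose E k := [set w | branch_config pi h o n w = k /\
                     forall u, (u < n)%N -> B u (o u w)].
have mE m : measurable [set w | forall u, (u < m)%N -> B u (o u w)].
  rewrite (_ : [set _ | _] =
      \bigcap_(u in [set u | (u < m)%N]) (o u @^-1` B u)).
    apply: bigcap_measurableType => u _.
    by rewrite -[_ @^-1` _]setTI; exact: mo.
  by apply/seteqP; split => w /=.
have mEk k : measurable (E k).
  exact: (measurableI _ _ (@measurable_branch_config n k) (mE n)).
(* The cylinder is split according to the configuration at time [n], where the branch property
   factors out the last draw. *)
transitivity (\sum_k P (E k) * outcome_law J k (B n))%E.
  rewrite [LHS](measure_fiber_sum P (@measurable_branch_config n) (mE n.+1)).
  by apply: eq_bigr => k _; exact: branch_o.2.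
transitivity (\int[P]_w
    \sum_k outcome_law J k (B n) * (\1_(E k) w)%:E)%E.
  rewrite ge0_integral_sum//; last 2 first.
  - by move=> k; apply: measurable_funeM; exact/measurable_EFinP.
  - by move=> k w _; rewrite mule_ge0// lee_fin.
  apply: eq_bigr => k _; rewrite ge0_integralZl//; last first.
    exact/measurable_EFinP.
  by rewrite integral_indic// setIT muleC.
apply: eq_integral => w _.
transitivity (outcome_law J (branch_config pi h o n w) [set x |
    forall u, (u <= n)%N -> B u (if (u < n)%N then o u w else x)]); last by [].
(* At a given [w] only the configuration actually reached contributes. *)
rewrite (bigD1 (branch_config pi h o n w))//= big1 ?adde0; last first.
  by move=> k /eqP kw; rewrite indicE memNset ?mule0// => -[/esym /kw].
have [Bw|Bw] := pselect (forall u, (u < n)%N -> B u (o u w)).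
  rewrite indicE mem_set// mule1; congr (outcome_law J _ _).
  apply/seteqP; split => x /=.
    move=> Bx u; rewrite leq_eqVlt => /predU1P[->|un].
      by rewrite ltnn.
    by rewrite un; exact: Bw.
  by move=> /(_ n (leqnn n)); rewrite ltnn.
rewrite indicE memNset ?mule0; last by case.
rewrite (_ : [set x | _] = set0) ?measure0//; apply/seteqP; split => // x /= Bx.
apply: Bw => u un.
by have := Bx u (ltnW un); rewrite un.
Qed.

(** Induction on [n] with [eta] general: the innermost operator is the last step of the branch, and
    [branch_one_step] replaces its fresh outcome by the one at time [n]. *)
Lemma iter_policy_operator_branch n eta (B : set (rvec R A)) : measurable B ->
  iter n (policy_operator J pi) eta h B =
  (\int[P]_w eta (branch_config pi h o n w)
     [set z | B (path_return (discount J) (o^~ w) n z)])%E.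
Proof.
move=> mB; elim: n eta => [eta|n IHn eta].
  under eq_integral => w _.
    rewrite (_ : [set z | _] = B); last first.
      by apply/seteqP; split => z /=; rewrite path_return0.
    over.
  by rewrite /= integral_cst// [X in (_ * X)%E]probability_setT mule1.
rewrite iterSr IHn.
(* The conditional probability of [B] given the outcomes up to and including time [n]. *)
pose phi (f : path_space (outcome R S A) n) : \bar R :=
  eta (next_config pi (f n)) [set z | B (path_return (discount J) f n.+1 z)].
have mphi : measurable_fun setT phi.
  apply: (@measurable_finite_kernel _ _ _ (path_space (outcome R S A) n)
    (rvec R A) (rvec R A) R _ (fun f => next_config pi (f n)) eta
    (fun x => path_return (discount J) x.1 n.+1 x.2)) => //.
    move=> k; rewrite -[X in measurable X]setTI.
    exact: (@measurable_path_eval _ (outcome R S A) n n (leqnn n)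
      measurableT _ (measurable_next_config pi k)).
  apply: (measurable_path_return (discount J)
    (g := fun t (f : path_space (outcome R S A) n) => f t)) => t tn.
  exact: measurable_path_eval.
rewrite [RHS](branch_one_step mphi)//.
apply: eq_integral => w _; apply: eq_integral => x _.
rewrite /phi /backup_law /distribution /pushforward.
have -> : splice n (w, x) n = x by rewrite /splice ltnn.
congr (eta _ _); apply/seteqP; split => z /=.
  rewrite (@path_returnS _ _ _ _ _ (o^~ w)) => [|t tn].
    by rewrite /splice ltnn.
  by rewrite /splice tn.
rewrite (@path_returnS _ _ _ _ _ (o^~ w)) => [|t tn].
  by rewrite /splice ltnn.
by rewrite /splice tn.
Qed.

(** At each time the outcome can be redrawn from an outcome law, under which the exceptional set [N]
    is null; there are countably many times. *)
Lemma branch_reward_itv_ae :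
  \forall w \ae P, forall t i, 0 <= reward (o t w) i <= 1.
Proof.
apply: ae_foralln => t.
pose N : set (outcome R S A) := ~` [set x | forall i, 0 <= reward x i <= 1].
have mN : measurable N by apply: measurableC; exact: measurable_reward_itv.
have mNt : measurable (o t @^-1` N) by rewrite -[_ @^-1` _]setTI; exact: mo.
exists (o t @^-1` N); split => //.
have mphi : measurable_fun setT
    (fun f : path_space (outcome R S A) t => (\1_N (f t))%:E : \bar R).
  apply/measurable_EFinP.
  by apply: measurableT_comp => //; exact: measurable_path_eval.
transitivity (\int[P]_w (\1_N (o t w))%:E)%E.
  by rewrite (integral_indic P measurableT mNt) setIT.
rewrite (branch_one_step mphi)//.
rewrite integral0_eq// => w _.
under eq_integral do rewrite /splice ltnn.
rewrite integral_indic// setIT.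
apply/negligibleP => //; exact: outcome_reward_itv_ae.
Qed.

End branch.

(** * Discounted tails and coupling along a branch *)

Lemma discounted_tail_le (R : realType) (gamma : R) (r : nat -> R) (l : R) n :
  0 < gamma < 1 -> (forall t, 0 <= r t <= 1) ->
  series (fun t => gamma ^+ t * r t) @ \oo --> l ->
  `|series (fun t => gamma ^+ t * r t) n - l| <= gamma ^+ n / (1 - gamma).
Proof.
move=> /andP[g0 g1] r01 ul.
set u := series _ in ul *.
have uS m : u m.+1 = u m + gamma ^+ m * r m.
  by rewrite /u /series /= big_nat_recr.
(* The upper bounds [u m + gamma ^+ m / (1 - gamma)] decrease to [l]. *)
pose v m := u m + gamma ^+ m / (1 - gamma).
have cvg_v : v @ \oo --> l.
  rewrite -[l]addr0; apply: cvgD => //.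
  rewrite -[X in _ --> X](mul0r (1 - gamma)^-1); apply: cvgMl.
  by apply: cvg_expr; rewrite ger0_norm ?ltW.
have u_le : u n <= l.
  rewrite -(cvg_lim _ ul)//; apply: nondecreasing_cvgn_le; last exact: cvgP ul.
  apply/nondecreasing_seqP => m; rewrite uS lerDl.
  by have /andP[r0 _] := r01 m; rewrite mulr_ge0// exprn_ge0// ltW.
have le_v : l <= v n.
  rewrite -(cvg_lim _ cvg_v)//.
  apply: nonincreasing_cvgn_ge; last exact: cvgP cvg_v.
  apply/nonincreasing_seqP => m; rewrite /v uS -addrA lerD2l exprSr.
  have /andP[_ r1] := r01 m.
  have gm : 0 <= gamma ^+ m by rewrite exprn_ge0// ltW.
  rewrite -lerBrDr -mulrBl (_ : _ - _ = gamma ^+ m * (1 - gamma)); last by ring.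
  by rewrite mulfK ?ler_piMr// subr_eq0 gt_eqF.
rewrite distrC ger0_norm ?subr_ge0// lerBlDl.
exact: le_v.
Qed.

Lemma measurable_supdist (R : realType) (A : finType) :
  measurable_fun setT (fun z : rvec R A * rvec R A => supdist z.1 z.2).
Proof.
apply: (measurableT_comp (@measurable_supnorm R A)).
apply/measurable_fun_tnthP => i.
rewrite (_ : _ \o _ = (fun z : rvec R A * rvec R A =>
    coordinate i z.1 - coordinate i z.2)); last first.
  by apply/funext => z /=; rewrite tnth_mktuple.
have mi := @measurable_coordinate R A i.
apply: measurable_funB.
  exact: (measurableT_comp mi measurable_fst).
exact: (measurableT_comp mi measurable_snd).
Qed.

Section branch_coupling.
Context (R : realType) (S : finPointedType) (A : finType) (J : JMDP R S A).
Context dW (W : measurableType dW) (P : probability W R).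
Variables (pi : S -> A) (h : config S A) (o : nat -> W -> outcome R S A).
Variables (Z : {mfun W >-> rvec R A}) (mu : probability (rvec R A) R).
Hypothesis branch_o : branch_process J pi h P o.
Hypothesis cvg_Z : {ae P, forall w i,
  series (fun t => discount J ^+ t * reward (o t w) i) @ \oo --> tnth (Z w) i}.
Hypothesis muE : forall B, measurable B -> mu B = distribution P Z B.

Let F n (x : W * rvec R A) : rvec R A * rvec R A :=
  (path_return (discount J) (o^~ x.1) n x.2, Z x.1).

Let measurable_F n : measurable_fun setT (F n).
Proof.
apply: measurable_fun_pair.
  by apply: (measurable_path_return _ (g := o)) => t _; exact: branch_o.1.
exact: (measurableT_comp (@measurable_funPT _ _ _ _ Z) measurable_fst).
Qed.

(* The coupling runs one branch, reads off its full return, and replaces the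
   rewards from time [n] on by a draw from [eta] at the configuration reached
   then. *)
Let coupling (eta : law_family R S A) n := randomized_law P eta
  (measurable_branch_config branch_o n) (measurable_F n).

(** The first marginal is the branch formula for the iterates. For the second, the draw from [eta]
    is ignored, so its probability is the indicator of [Z w] being in [B]. *)
Lemma coupling_marginals eta n :
  couplings (iter n (policy_operator J pi) eta h) mu (coupling eta n).
Proof.
move=> B mB; split; rewrite randomized_lawE.
  rewrite (iter_policy_operator_branch branch_o n eta mB).
  apply: eq_integral => w _; congr (eta _ _).
  by apply/seteqP; split => z /= => [[]|].
rewrite muE// /distribution /pushforward -[in RHS](setIT (Z @^-1` B)).
have mZB : measurable (Z @^-1` B).
  by rewrite -[_ @^-1` _]setTI; exact: measurable_funPT.
rewrite -integral_indic//; apply: eq_integral => w _.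
have [BZ|BZ] := pselect (B (Z w)).
  rewrite indicE mem_set// (_ : [set v | _] = setT) ?probability_setT//.
  by apply/seteqP; split.
rewrite indicE memNset// (_ : [set v | _] = set0) ?measure0//.
by apply/seteqP; split => // z [].
Qed.

(** In the coupling the two returns differ by at most [gamma ^ n] times the shifted norm of the
    terminal draw; integrating the [p]th power and taking the root gives the bound. *)
Lemma wasserstein_iter_branch p (eta : law_family R S A) n (C : R) :
  1 <= p -> 0 <= C ->
  (forall k, (\int[eta k]_z (((1 - discount J)^-1 + supnorm z) `^ p)%:E
     <= C%:E)%E) ->
  (wasserstein p (iter n (policy_operator J pi) eta h) mu
     <= (discount J ^+ n * C `^ p^-1)%:E)%E.
Proof.
move=> p1 C0 etaC; set g := discount J in etaC *.
have p0 : 0 < p by rewrite (lt_le_trans _ p1).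
have /andP[g0 g1] : 0 < g < 1 := discount_itv J.
have gn0 : 0 <= g ^+ n by rewrite exprn_ge0// ltW.
have c0 : 0 <= (1 - g)^-1 by rewrite invr_ge0 subr_ge0 ltW.
pose f (z : rvec R A * rvec R A) := ((supdist z.1 z.2) `^ p)%:E.
have mf : measurable_fun setT f.
  apply/measurable_EFinP.
  exact: (measurableT_comp (@measurable_powR R p) (@measurable_supdist R A)).
have f0 z : (0 <= f z)%E by rewrite lee_fin powR_ge0.
have cost_le : (\int[coupling eta n]_z f z <= ((g ^+ n) `^ p * C)%:E)%E.
  rewrite ge0_integral_randomized_law//.
  apply: (@le_trans _ _ (\int[P]_w ((g ^+ n) `^ p * C)%:E)%E); last first.
    by rewrite integral_cst// [X in (_ * X)%E]probability_setT mule1.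
  apply: ae_ge0_le_integral => //.
  - by move=> w _; exact: integral_ge0.
  - apply: (measurable_randomized_integral _
      (measurable_branch_config branch_o n) (measurable_F n)) => //.
  - by move=> w _; rewrite lee_fin mulr_ge0// powR_ge0.
  apply: filterS2 cvg_Z (branch_reward_itv_ae branch_o) => w Zw rw _.
  rewrite EFinM; apply: (@le_trans _ _ (((g ^+ n) `^ p)%:E *
    \int[eta (branch_config pi h o n w)]_z
      (((1 - g)^-1 + supnorm z) `^ p)%:E)%E); last first.
    by apply: lee_wpmul2l; [rewrite lee_fin powR_ge0|exact: etaC].
  rewrite -ge0_integralZl//; last 3 first.
  - exact: measurable_shifted_moment.
  - by move=> z _; rewrite lee_fin powR_ge0.
  - by rewrite lee_fin powR_ge0.
  apply: ge0_le_integral => //.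
  - exact: (measurableT_comp mf (measurable_fiber (measurable_F n) w)).
  - by apply: measurable_funeM; exact: measurable_shifted_moment.
  move=> z _; rewrite /f -EFinM lee_fin -powRM//; last first.
    by rewrite addr_ge0// supnorm_ge0.
  have rhs0 : 0 <= g ^+ n * ((1 - g)^-1 + supnorm z).
    by rewrite mulr_ge0// addr_ge0// supnorm_ge0.
  apply: ge0_ler_powR; rewrite ?nnegrE ?supnorm_ge0 ?(ltW p0)//.
  (* The difference regroups into the partial sum minus its limit, bounded by the geometric tail,
     and the discounted terminal draw. *)
  apply: supnorm_le => // i; rewrite !tnth_mktuple /= addrAC mulrDr.
  rewrite (le_trans (ler_normD _ _))// lerD//.
    exact: (discounted_tail_le n (discount_itv J) (fun t => rw t i) (Zw i)).
  by rewrite normrM ger0_norm// ler_wpM2l// le_supnorm.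
apply: (@le_trans _ _ ((\int[coupling eta n]_z f z) `^ p^-1)%E).
  apply: ereal_inf_lbound; exists (coupling eta n) => //.
  exact: coupling_marginals.
have I0 : (0 <= \int[coupling eta n]_z f z)%E by exact: integral_ge0.
have Ifin : (\int[coupling eta n]_z f z)%E \is a fin_num.
  by rewrite ge0_fin_numE// (le_lt_trans cost_le)// ltry.
rewrite -(fineK Ifin) poweR_EFin lee_fin.
have -> : g ^+ n * C `^ p^-1 = ((g ^+ n) `^ p * C) `^ p^-1.
  by rewrite powRM ?powR_ge0// -powRrM mulfV ?gt_eqF// powRr1.
apply: ge0_ler_powR; rewrite ?nnegrE ?fine_ge0 ?invr_ge0 ?(ltW p0)//.
  by rewrite mulr_ge0// powR_ge0.
by rewrite -lee_fin fineK.
Qed.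

End branch_coupling.

(** * Convergence of the iterates *)

Lemma wasserstein_ge0 (R : realType) (A : finType) (p : R)
    (xi ups : probability (rvec R A) R) :
  (0 <= wasserstein p xi ups)%E.
Proof. by apply: le_ereal_inf_tmp => _ [lam _ <-]; exact: poweR_ge0. Qed.

(** The maximum starts from [-oo], so nonnegativity is drawn from the term at one configuration
    [h]. *)
Lemma wasserstein_max_ge0 (R : realType) (S : finPointedType) (A : finType)
    (p : R) (h : config S A) (eta zeta : law_family R S A) :
  (0 <= wasserstein_max p eta zeta)%E.
Proof.
apply: (le_trans (wasserstein_ge0 p (eta h) (zeta h))).
exact: (le_bigmax _ (fun k => wasserstein p (eta k) (zeta k))).
Qed.

Lemma cvg_expr_cst0 (R : realType) (gamma C : R) : 0 < gamma < 1 ->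
  (fun n => (gamma ^+ n * C)%:E) @ \oo --> 0%E.
Proof.
move=> /andP[g0 g1]; apply: cvg_EFin; first exact: nearW.
rewrite -[X in _ --> X](mul0r C); apply: cvgMl.
by apply: cvg_expr; rewrite ger0_norm ?ltW.
Qed.

Theorem theorem1 (R : realType) (S : finPointedType) (A : finType)
    (J : JMDP R S A) (Qstar : S -> A -> R) (pistar : S -> A)
    (etastar : law_family R S A) (p : R) (G : law_family R S A -> S -> A)
    (eta0 : law_family R S A)
    (card_A : (2 <= #|A|)%N)
    (Qstar_optimal : is_optimal_Q J Qstar)
    (unique_optimal : forall s, argmax (Qstar s) = [set pistar s])
    (etastar_return : is_return_family J pistar etastar)
    (p_ge1 : 1 <= p)
    (G_greedy : forall eta, consistent_family p eta ->
       forall s, argmax (Qmean eta s) (G eta s))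
    (eta0_consistent : consistent_family p eta0) :
  let eta_ k := iter k (greedy_operator J G) eta0 in
  (fun k => wasserstein_max p (eta_ k) etastar) @ \oo --> 0%E /\
  (forall s, (fun k => wasserstein p (eta_ k (diag_config A s))
                         (etastar (diag_config A s))) @ \oo --> 0%E).
Proof.
move=> eta_.
have [K _ greedyK] := eventually_greedy_optimal Qstar_optimal unique_optimal
  p_ge1 G_greedy eta0_consistent.
(* From [K] on the greedy policy is [pistar], so the iteration becomes that of one fixed
   operator. *)
have eta_shift n : eta_ (n + K)%N = iter n (policy_operator J pistar) (eta_ K).
  elim: n => [//|n IHn]; rewrite addSn [LHS]/= iterS -IHn /greedy_operator.
  by rewrite greedyK//=; exact: leq_addl.
have [etaK_moment _] := greedy_iter_consistent J G p_ge1 eta0_consistent K.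
have /andP[g0 g1] := discount_itv J.
have c0 : 0 <= (1 - discount J)^-1 by rewrite invr_ge0 subr_ge0 ltW.
(* The bound must be uniform in the configuration, since the one reached after [n] steps is
   random. *)
have [C C0 etaKC] :=
  uniform_shifted_moment (le_trans ler01 p_ge1) c0 etaK_moment.
have dist_le n h : (wasserstein p (eta_ (n + K)%N h) (etastar h) <=
    (discount J ^+ n * C `^ p^-1)%:E)%E.
  rewrite eta_shift.
  have [dW [W [P [out [Z [branch_o cvg_Z muE]]]]]] := etastar_return h.
  exact: (wasserstein_iter_branch branch_o cvg_Z muE n p_ge1 C0 etaKC).
have cvg0 := cvg_expr_cst0 (C `^ p^-1) (discount_itv J).
(* Shifting the index by [K] keeps the limit and brings the sequence into the range of [dist_le]. *)
split=> [|s]; rewrite -(cvg_shiftn K).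
  have a : A by apply: (enum_val (A := A)); exact: (Ordinal (ltnW card_A)).
  apply: (squeeze_cvge _ (@cvg_cst _ _ _ _ _) cvg0).
  apply: nearW => n; apply/andP; split.
    exact: (wasserstein_max_ge0 p (diag_config A point)).
  by apply: bigmax_le => [|h _]; [rewrite leNye|exact: dist_le].
apply: (squeeze_cvge _ (@cvg_cst _ _ _ _ _) cvg0).
by apply: nearW => n; rewrite wasserstein_ge0 dist_le.
Qed.
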